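(* Let $G=(V,E)$ be a finite oriented graph. Then $\mathcal{B}_G$ is in bijection with the set $\{I_{{}_\sigma G}: \sigma\subseteq E \text{ a totally cyclic reorientation of } G\}$.
   Context: Oriented graphs may have loops and multiple edges. The incidence matrix $A\in\{0,\pm1\}^{V\times E}$ has $A_{v,e}=1$ if the non-loop edge $e$ enters $v$, $-1$ if it leaves $v$, $0$ otherwise. $\mathcal{B}_G=\{b\in\mathbb{Z}^V: \exists p\in\mathbb{R}^E \text{ with } Ap=b,\ 0<p_e<1\ \forall e\}$. For an oriented graph $H$ on vertex set $V$, the in-degree sequence $I_H\in\mathbb{Z}^V$ records for each vertex $v$ the number of edges of $H$ entering $v$. For $\sigma\subseteq E$, ${}_\sigma G$ is $G$ with the edges of $\sigma$ reversed; $\sigma$ is a totally cyclic reorientation if every edge of ${}_\sigma G$ lies on a directed cycle. *)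

(* Defs.v *)
From mathcomp Require Export all_boot all_order all_algebra.
From mathcomp Require Export classical_sets functions reals.

Set Implicit Arguments.
Unset Strict Implicit.
Unset Printing Implicit Defensive.

Import GRing.Theory Num.Theory.
Local Open Scope ring_scope.
Local Open Scope classical_set_scope.

(* Loops (tail e = head e) and parallel edges are allowed. *)
Record ograph (V E : finType) := OGraph { tail : E -> V; head : E -> V }.

Section OrientedGraphs.
Variables V E : finType.
Implicit Types (G : ograph V E) (sigma : {set E}).

Definition incidence G (v : V) (e : E) : int :=
  if tail G e == head G e then 0
  else if head G e == v then 1
  else if tail G e == v then -1
  else 0.

Definition BG (R : realType) G : set {ffun V -> int} :=
  [set b | exists p : E -> R,
     (forall v, \sum_(e : E) (incidence G v e)%:~R * p e = (b v)%:~R) /\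
     (forall e, 0 < p e < 1)].

(* A loop enters its vertex, so it contributes 1 to the in-degree. *)
Definition indegree G : {ffun V -> int} :=
  [ffun v => #|[pred e | head G e == v]|%:Z].

Definition reorient sigma G : ograph V E :=
  OGraph (fun e => if e \in sigma then head G e else tail G e)
         (fun e => if e \in sigma then tail G e else head G e).

(* The cyclic sequence of edges c is simple: it visits no vertex twice.
   A loop is a directed cycle of length 1. *)
Definition directed_cycle G (c : seq E) : bool :=
  [&& c != [::], cycle (fun e f => head G e == tail G f) c
    & uniq [seq tail G e | e <- c]].

Definition totally_cyclic G : Prop :=
  forall e : E, exists2 c : seq E, directed_cycle G c & e \in c.

Definition totally_cyclic_reorientation G sigma : Prop :=
  totally_cyclic (reorient sigma G).

Definition totally_cyclic_indegrees G : set {ffun V -> int} :=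
  [set indegree (reorient sigma G)
    | sigma in [set sigma | totally_cyclic_reorientation G sigma]].

End OrientedGraphs.

(* Main.v *)
Require Import Defs.
From mathcomp Require Import zify ring lra.

(** The bijection is the translation [b |-> b + outdegree G].  Given [p] with
    values in ]0, 1[ and [A p = b], and a reorientation H of G along sigma, let
    [y e] be [p e] on sigma and [1 - p e] off sigma.  Then [y > 0], and the net
    flow of [y] into [v] in H is the excess
    [indegree H v - (b v + outdegree G v)].
    Across a vertex set that no edge of H leaves, the net inflow of [y] is
    nonnegative, and positive as soon as some edge enters.  Hence, if sigma
    minimises the total absolute excess, the excess vanishes: otherwise a vertex
    of negative excess reaches one of positive excess, and reversing a simple
    path between them lowers the total.  Once the excess is zero, [y] is a
    positive circulation, so the tail of each edge is reachable from its head,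
    and H is totally cyclic.  Conversely, adding up cycles through all edges of
    a totally cyclic H gives a positive circulation, which rescaled yields
    [p]. *)

Set Implicit Arguments.
Unset Strict Implicit.
Unset Printing Implicit Defensive.

Import Order.TTheory GRing.Theory Num.Theory.
Local Open Scope ring_scope.

Section Flows.
Variables V E : finType.
Implicit Types (G H : ograph V E) (sigma tau : {set E}).

(** * Degrees and net inflow under reorientation *)

Definition outdegree G : {ffun V -> int} :=
  [ffun v => #|[pred e | tail G e == v]|%:Z].

Definition net_inflow (R : numDomainType) H (y : E -> R) (v : V) : R :=
  \sum_(e : E) ((head H e == v)%:R - (tail H e == v)%:R) * y e.

Definition adjacent H : rel V :=
  fun u w => [exists e, (tail H e == u) && (head H e == w)].

Definition chained H : rel E := fun e f => head H e == tail H f.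

Lemma incidenceE G v e :
  incidence G v e = (head G e == v)%:R - (tail G e == v)%:R.
Proof.
rewrite /incidence; have [->|ne] := eqVneq (tail G e) (head G e).
  by rewrite subrr.
have [hv|nh] := eqVneq (head G e) v.
  by rewrite -hv (negbTE ne) subr0.
by have [tv|nt] := eqVneq (tail G e) v; rewrite ?sub0r ?subr0.
Qed.

Lemma card_sumr (R : pzSemiRingType) (P : pred E) :
  #|[pred e | P e]|%:R = \sum_(e : E) (P e)%:R :> R.
Proof. by rewrite -natr_sum -sum1_card big_mkcond. Qed.

Lemma indegreeE (R : pzRingType) H v :
  (indegree H v)%:~R = \sum_(e : E) (head H e == v)%:R :> R.
Proof. by rewrite ffunE -pmulrn card_sumr. Qed.

Lemma outdegreeE (R : pzRingType) H v :
  (outdegree H v)%:~R = \sum_(e : E) (tail H e == v)%:R :> R.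
Proof. by rewrite ffunE -pmulrn card_sumr. Qed.

(** Edge by edge: on [sigma] the new head is the old tail, so the two degree terms cancel; off
    [sigma] they come from the constant 1 in [1 - p e]. *)
Lemma net_inflow_reorient (R : numDomainType) G sigma (p : E -> R) v :
  net_inflow (reorient sigma G)
    (fun e => if e \in sigma then p e else 1 - p e) v =
  (indegree (reorient sigma G) v)%:~R - (outdegree G v)%:~R
    - \sum_(e : E) (incidence G v e)%:~R * p e.
Proof.
rewrite indegreeE outdegreeE -!sumrB; apply: eq_bigr => e _ /=.
rewrite incidenceE rmorphB /= !natz -!pmulrn.
by case: (e \in sigma); ring.
Qed.

Lemma indegree_reorient H tau v :
  indegree (reorient tau H) v =
  indegree H v + \sum_(e in tau) ((tail H e == v)%:R - (head H e == v)%:R).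
Proof.
have := indegreeE int (reorient tau H) v; have := indegreeE int H v.
rewrite !intz => -> ->; rewrite [X in _ + X]big_mkcond -big_split /=.
by apply: eq_bigr => e _; case: (e \in tau); rewrite ?addr0 // addrC subrK.
Qed.

(** Reversals compose by symmetric difference, so reversing a path in a reorientation of [G] yields
    another candidate for the minimisation. *)
Lemma indegree_reorient_reorient G sigma tau :
  exists rho, indegree (reorient tau (reorient sigma G)) =
              indegree (reorient rho G).
Proof.
exists [set e | (e \in sigma) (+) (e \in tau)].
apply/ffunP => v; rewrite !ffunE; congr (_%:Z); apply: eq_card => e.
by rewrite !inE /= inE; case: (e \in tau); case: (e \in sigma).
Qed.

(** * Net inflow into closed vertex sets *)

Section Cuts.
Variables (R : numDomainType) (H : ograph V E) (y : E -> R) (S : {set V}).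
Hypothesis y_gt0 : forall e, 0 < y e.
Hypothesis S_closed : forall e, tail H e \in S -> head H e \in S.

Lemma sum_net_inflow (A : {set V}) : \sum_(v in A) net_inflow H y v =
  \sum_(e : E) ((head H e \in A)%:R - (tail H e \in A)%:R) * y e.
Proof.
have sum_delta (u : V) : \sum_(v in A) (u == v)%:R = (u \in A)%:R :> R.
  case: (boolP (u \in A)) => uA.
    rewrite (bigD1 u) //= eqxx big1 ?addr0 // => v /andP[_ vu].
    by rewrite eq_sym (negbTE vu).
  by rewrite big1 // => v vA; case: eqP uA vA => // ->; case: (v \in A).
rewrite exchange_big /=; apply: eq_bigr => e _.
by rewrite -mulr_suml sumrB !sum_delta.
Qed.

Let inflow_term_ge0 e : 0 <= ((head H e \in S)%:R - (tail H e \in S)%:R) * y e.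
Proof.
apply: mulr_ge0; last exact: ltW; rewrite subr_ge0 ler_nat.
by case: (boolP (tail H e \in S)) => // /S_closed ->.
Qed.

Lemma sum_net_inflow_closed_ge0 : 0 <= \sum_(v in S) net_inflow H y v.
Proof. by rewrite sum_net_inflow sumr_ge0. Qed.

(** For closed [S] every edge term is nonnegative, and an edge entering [S] from outside would
    contribute [y e > 0] to a zero sum. *)
Lemma circulation_closed_tail e :
  \sum_(v in S) net_inflow H y v = 0 -> head H e \in S -> tail H e \in S.
Proof.
rewrite sum_net_inflow => S0 hS; apply: contraT => tS.
have := psumr_eq0P (fun i _ => inflow_term_ge0 i) S0 (i := e) isT.
by rewrite hS (negbTE tS) subr0 mul1r => ye; have := y_gt0 e; rewrite ye ltxx.
Qed.

End Cuts.

(** * Simple paths: reversal and closing up to cycles *)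

Definition reach H u : {set V} := [set w | connect (adjacent H) u w].

Lemma reach_refl H u : u \in reach H u.
Proof. by rewrite inE connect0. Qed.

Lemma reach_closed H u e : tail H e \in reach H u -> head H e \in reach H u.
Proof.
rewrite !inE => /connect_trans; apply; apply: connect1.
by apply/existsP; exists e; rewrite !eqxx.
Qed.

Lemma path_edges H u q : path (adjacent H) u q ->
  exists c, [seq tail H e | e <- c] = belast u q /\ [seq head H e | e <- c] = q.
Proof.
elim: q u => [|w q IHq] u /=; first by exists [::].
case/andP=> /existsP[e /andP[/eqP te /eqP he]] /IHq[c [tc hc]].
by exists (e :: c); rewrite /= te he tc hc.
Qed.

Lemma reach_edges H u w : w \in reach H u -> exists q c,
  [/\ uniq (u :: q), last u q = w, [seq tail H e | e <- c] = belast u q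
    & [seq head H e | e <- c] = q].
Proof.
rewrite inE => /connectP[q0 pq ->].
case/shortenP: pq => q pq uq _.
by have [c [tc hc]] := path_edges pq; exists q, c.
Qed.

Lemma reverse_path H s t : t \in reach H s -> exists tau,
  forall v, indegree (reorient tau H) v =
            indegree H v + (s == v)%:R - (t == v)%:R.
Proof.
case/reach_edges=> q [c [uq lq tc hc]].
(* Without repeated edges, the sum over the set of reversed edges is a sum along the list [c]. *)
have uc : uniq c.
  apply: (map_uniq (f := tail H)); rewrite tc.
  by move: uq; rewrite lastI rcons_uniq => /andP[].
exists [set e in c] => v.
rewrite indegree_reorient -addrA; congr (_ + _).
rewrite (eq_bigl (mem c)); last by move=> e; rewrite inE.
rewrite -big_uniq //= sumrB -(big_map (tail H) xpredT (fun u => (u == v)%:R)).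
rewrite -(big_map (head H) xpredT (fun u => (u == v)%:R)) tc hc.
(* The tails are all path vertices but the last and the heads all but the first, so only the
   endpoints survive. *)
have /(congr1 (fun l => \sum_(u <- l) (u == v)%:R : int)) := lastI s q.
rewrite big_cons big_rcons /= lq => eq_sum.
by lra.
Qed.

Lemma chained_path H e0 e c (q : seq V) :
  [seq tail H f | f <- c] = belast (head H e) q ->
  [seq head H f | f <- c] = q -> last (head H e) q = tail H e0 ->
  path (chained H) e (rcons c e0).
Proof.
elim: c e q => [|f c IHc] e [|w q] //=.
  by rewrite /chained => _ _ ->; rewrite eqxx.
case=> tf tc [hf hc] lt; rewrite {1}/chained tf eqxx /=.
by apply: (IHc f q); rewrite ?hf.
Qed.

Lemma directed_cycle_reach H e :
  tail H e \in reach H (head H e) ->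
  exists2 c, directed_cycle H c & e \in c.
Proof.
case/reach_edges=> q [c [uq lq tc hc]].
exists (e :: c); last exact: mem_head.
(* The tails of [e :: c] are the path vertices with the last one moved to the front, hence
   distinct. *)
rewrite /directed_cycle /= tc -rcons_uniq -lq -lastI uq andbT.
exact: (chained_path tc hc lq).
Qed.

Lemma cycle_heads H c : cycle (chained H) c ->
  [seq head H e | e <- c] = rot 1 [seq tail H e | e <- c].
Proof.
case: c => //= e c; rewrite rot1_cons.
(* The starting edge is generalised while the closing edge stays fixed. *)
elim: c {1 3}e => [|f c IHc] e0 /=; first by case/andP => /eqP->.
by case/andP=> /eqP-> /IHc ->.
Qed.

(** * Circulations, total cyclicity and excess *)

Section Circulations.
Variables (R : realFieldType) (H : ograph V E).

Lemma totally_cyclic_circulation : totally_cyclic H ->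
  exists y : E -> R, (forall e, 0 < y e < 1) /\ forall v, net_inflow H y v = 0.
Proof.
move=> tcH.
have exc (f : E) : exists c, directed_cycle H c && (f \in c).
  by have [c Hc fc] := tcH f; exists c; rewrite Hc.
pose c f := xchoose (exc f).
pose y e : R := \sum_f (count_mem e (c f))%:R.
have y_gt0 e : 0 < y e.
  rewrite /y (bigD1 e) //= ltr_pwDl ?sumr_ge0 //.
  by rewrite ltr0n -has_count has_pred1; have /andP[] := xchooseP (exc e).
have y0 v : net_inflow H y v = 0.
  rewrite /net_inflow; under eq_bigr do rewrite mulr_sumr.
  rewrite exchange_big big1 //= => f _.
  (* Weighting by multiplicity amounts to summing along the cycle, whose heads are a permutation of
     its tails. *)
  transitivity (\sum_(e <- c f) ((head H e == v)%:R - (tail H e == v)%:R) : R).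
    elim: (c f) => [|e s IHs].
      by rewrite big_nil big1 // => e _; rewrite mulr0.
    rewrite big_cons -IHs (eq_bigr (fun i => (e == i)%:R *
       ((head H i == v)%:R - (tail H i == v)%:R) +
       ((head H i == v)%:R - (tail H i == v)%:R) * (count_mem i s)%:R)).
      rewrite big_split /= (bigD1 e) //= eqxx mul1r big1 ?addr0 // => i ie.
      by rewrite eq_sym (negbTE ie) mul0r.
    by move=> i _; rewrite /= natrD mulrDr [X in X + _]mulrC.
  have /andP[/and3P[_ cyc _] _] := xchooseP (exc f).
  rewrite sumrB -(big_map (head H) xpredT (fun u => (u == v)%:R)).
  rewrite -(big_map (tail H) xpredT (fun u => (u == v)%:R)) (cycle_heads cyc).
  by apply/eqP; rewrite subr_eq0; apply/eqP/perm_big; rewrite perm_rot.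
(* The extra 1 keeps [y e / M] below 1 even if [e] is the only edge. *)
pose M := \sum_e y e + 1.
have M_gt e : y e < M.
  rewrite /M (bigD1 e) //= -addrA ltrDl ltr_wpDl // sumr_ge0 // => i _.
  exact: ltW.
exists (fun e => y e / M); split=> [e|v].
  have M_gt0 := lt_trans (y_gt0 e) (M_gt e).
  by rewrite divr_gt0 //= ltr_pdivrMr // mul1r.
rewrite -[RHS](mul0r M^-1) -(y0 v) /net_inflow mulr_suml.
by apply: eq_bigr => e _; rewrite mulrA.
Qed.

Lemma circulation_totally_cyclic (y : E -> R) :
  (forall e, 0 < y e) -> (forall v, net_inflow H y v = 0) -> totally_cyclic H.
Proof.
move=> y_gt0 y0 e; apply: directed_cycle_reach.
apply: (circulation_closed_tail y_gt0 (@reach_closed H _) _ (reach_refl H _)).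
by rewrite big1.
Qed.

Lemma excess_path (y : E -> R) (d : V -> int) :
  (forall e, 0 < y e) ->
  (forall v, net_inflow H y v = (indegree H v - d v)%:~R) ->
  (exists v, indegree H v != d v) ->
  exists s t, [/\ t \in reach H s, indegree H s < d s & d t < indegree H t].
Proof.
move=> y_gt0 yd [v0 nv0].
(* The excesses sum to zero over all vertices; were none negative, all would vanish. *)
have [s ds] : exists s, indegree H s < d s.
  apply/existsP; apply: contraT; rewrite negb_exists => /forallP nlt.
  have ge0 v : v \in [set: V] -> 0 <= net_inflow H y v.
    by rewrite yd ler0z subr_ge0 leNgt nlt.
  have := sum_net_inflow H y [set: V].
  rewrite [RHS]big1 => [/(psumr_eq0P ge0)/(_ v0)|e _]; last first.
    by rewrite !inE subrr mul0r.
  rewrite inE yd => /(_ isT)/eqP.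
  by rewrite intr_eq0 subr_eq0 (negbTE nv0).
have [/existsP[t /andP[tS dt]]|] :=
  boolP [exists t, (t \in reach H s) && (d t < indegree H t)].
  by exists s, t.
rewrite negb_exists => /forallP nt.
(* With no positive excess reachable, the closed set [reach H s] would have negative net inflow. *)
have := sum_net_inflow_closed_ge0 y_gt0 (@reach_closed H s).
rewrite leNgt (bigD1 s) ?reach_refl //= ltr_wnDr // ?yd ?ltrz0 ?subr_lt0 //.
rewrite sumr_le0 // => v /andP[vS _]; rewrite yd lerz0 subr_le0.
by have := nt v; rewrite vS /= -leNgt.
Qed.

End Circulations.

Lemma reorient_indegree (R : realFieldType) G (p : E -> R) (b : V -> int) :
  (forall v, \sum_(e : E) (incidence G v e)%:~R * p e = (b v)%:~R) ->
  (forall e, 0 < p e < 1) ->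
  exists sigma, forall v, indegree (reorient sigma G) v = b v + outdegree G v.
Proof.
move=> pb p01; pose d v := b v + outdegree G v.
pose excess sigma := (\sum_v `|indegree (reorient sigma G) v - d v|)%N.
case: (@arg_minnP _ finset.set0 xpredT excess isT) => sigma _ min_sigma.
exists sigma => v0; apply/eqP/contraT => nv0.
set H := reorient sigma G in nv0.
pose y e := if e \in sigma then p e else 1 - p e.
have y_gt0 e : 0 < y e.
  by rewrite /y; case/andP: (p01 e) => ? ?; case: ifP; rewrite ?subr_gt0.
have yd v : net_inflow H y v = (indegree H v - d v)%:~R.
  by rewrite net_inflow_reorient pb rmorphB rmorphD /=; ring.
have [s [t [st ds dt]]] := excess_path y_gt0 yd (ex_intro _ v0 nv0).
have [tau tauE] := reverse_path st.
have [rho rhoE] := indegree_reorient_reorient G sigma tau.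
have := min_sigma rho isT; rewrite leqNgt => /negP[].
(* The reversal raises the in-degree at [s] and lowers it at [t] by one; integer excesses of the
   right sign cannot overshoot zero. *)
have le v : (`|indegree (reorient rho G) v - d v| <= `|indegree H v - d v|)%N.
  rewrite -rhoE tauE; case: (eqVneq s v) => [<-|_]; case: (eqVneq t _) => [|_];
    by [move=> ?; subst; lia | lia | move=> <-; lia].
rewrite /excess (bigD1 s) //= [X in (_ < X)%N](bigD1 s) //= -addSn.
apply: leq_add; last by apply: leq_sum => v _; exact: le.
rewrite -rhoE tauE eqxx -/H; have /negbTE-> : t != s.
  by apply: contraTneq dt => ->; rewrite -leNgt ltW.
by move: ds; clear; lia.
Qed.

End Flows.

Theorem theorem2p8 (R : realType) (V E : finType) (G : ograph V E) :
  exists f : {ffun V -> int} -> {ffun V -> int},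
    set_bij (BG R G) (totally_cyclic_indegrees G) f.
Proof.
exists (fun b => [ffun v => b v + outdegree G v]); split.
- move=> b [p [pb p01]].
  have [sigma sigmaE] := reorient_indegree pb p01.
  exists sigma; last by apply/ffunP => v; rewrite sigmaE !ffunE.
  apply: (@circulation_totally_cyclic _ _ R _
            (fun e => if e \in sigma then p e else 1 - p e)) => [e|v].
    by case/andP: (p01 e) => ? ?; case: ifP; rewrite ?subr_gt0.
  by rewrite net_inflow_reorient sigmaE pb rmorphD /= addrK subrr.
- move=> b b' _ _ /ffunP bb'; apply/ffunP => v.
  by have := bb' v; rewrite !ffunE => /addIr.
- move=> _ [sigma tc <-].
  exists [ffun v => indegree (reorient sigma G) v - outdegree G v]; last first.
    by apply/ffunP => v; rewrite 2!ffunE subrK.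
  have [y [y01 y0]] := totally_cyclic_circulation R tc.
  (* The flip between [p] and [y] is an involution preserving the open unit interval. *)
  pose p e := if e \in sigma then y e else 1 - y e.
  exists p; split=> [v|e]; last first.
    by case/andP: (y01 e) => ? ?; rewrite /p; case: ifP => _; lra.
  have yE : net_inflow (reorient sigma G)
      (fun e => if e \in sigma then p e else 1 - p e) v = 0.
    rewrite -(y0 v); apply: eq_bigr => e _; congr (_ * _).
    by rewrite /p; case: (e \in sigma) => //; rewrite subKr.
  move: yE; rewrite net_inflow_reorient => /eqP; rewrite subr_eq0 => /eqP <-.
  by rewrite -rmorphB !ffunE.
Qed.
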